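(* Let $\mathbf{k}$ be a field of characteristic zero, $n,k\ge 1$ integers, $I_{n,k}=(x_1^2,\dots,x_n^2,(x_1+\cdots+x_n)^k)\subset\mathbf{k}[x_1,\dots,x_n]$, let $\mathrm{in}(I_{n,k})$ be its initial ideal with respect to a term ordering with $x_1\succ\cdots\succ x_n$, and let $J_{n,k}$ be the ideal generated by the squarefree monomials in $\mathrm{in}(I_{n,k})$. Then for $p,s\ge 0$ the Betti numbers $\beta_{p,p+s}(J_{n,k})$ are zero if $n<2s-k$, and otherwise $$\beta_{p,p+s}(J_{n,k})=C^{k-1}_{s-k}\binom{s-k}{p}.$$
   Context: For a graded ideal $J$, $\beta_{p,j}(J)$ is the number of generators of degree $j$ of the $p$-th free module in the minimal graded free resolution of the ideal $J$ itself (so $\beta_{0,j}$ counts minimal generators of degree $j$). $C_i=\binom{2i}{i}-\binom{2i}{i-1}$ is the $i$-th Catalan number, and $C^{k-1}_r$ is the coefficient of $t^r$ in $\left(\sum_{i\ge 0}C_it^i\right)^k$; in particular $C^{k-1}_r=0$ for $r<0$ (so the formula is read as $0$ when $s<k$). *)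

(* Defs.v *)
From HB Require Import structures.
From mathcomp Require Import all_boot all_order all_algebra.
From mathcomp Require Import mpoly.
From Stdlib Require Import ClassicalEpsilon.

Set Implicit Arguments.
Unset Strict Implicit.
Unset Printing Implicit Defensive.

Import GRing.Theory.
Local Open Scope ring_scope.

Section Ideals.
Variables (F : fieldType) (n : nat).
Implicit Types (S I : {mpoly F[n]} -> Prop) (f : {mpoly F[n]}).

Definition ideal_gen S f : Prop :=
  exists l : seq ({mpoly F[n]} * {mpoly F[n]}),
    (forall x, x \in l -> S x.2) /\ f = \sum_(x <- l) x.1 * x.2.

Definition term_order (le : rel 'X_{1..n}) : Prop :=
  [/\ reflexive le, antisymmetric le, transitive le & total le] /\
  (forall m, le 0%MM m) /\
  (forall m m1 m2, le m1 m2 -> le (m1 + m)%MM (m2 + m)%MM).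

Definition leading_monom (le : rel 'X_{1..n}) f (m : 'X_{1..n}) : Prop :=
  m \in msupp f /\ forall m', m' \in msupp f -> le m' m.

Definition initial_ideal (le : rel 'X_{1..n}) I : {mpoly F[n]} -> Prop :=
  ideal_gen (fun g => exists f m, [/\ I f, leading_monom le f m & g = 'X_[m]]).

Definition squarefree_monom (m : 'X_{1..n}) : Prop := forall i, (m i <= 1)%N.

Definition squarefree_part I : {mpoly F[n]} -> Prop :=
  ideal_gen (fun g => exists m, [/\ squarefree_monom m, I 'X_[m] & g = 'X_[m]]).

Definition I_nk (k : nat) : {mpoly F[n]} -> Prop :=
  ideal_gen (fun g => (exists i, g = 'X_i ^+ 2) \/ g = (\sum_(i < n) 'X_i) ^+ k).

Definition J_nk (le : rel 'X_{1..n}) (k : nat) : {mpoly F[n]} -> Prop :=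
  squarefree_part (initial_ideal le (I_nk k)).

End Ideals.

Arguments I_nk : clear implicits.
Arguments J_nk F {n} le k.

(* The p-th module is the free module of row vectors of length [fc_rank p],
   whose i-th basis vector has degree [fc_deg i]; maps act by u |-> u *m D.
   Natural-number degrees lose nothing: in a minimal resolution of an ideal
   the basis vectors of the 0-th module map to nonzero polynomials. *)
Record free_complex (F : fieldType) (n : nat) := FreeComplex {
  fc_rank : nat -> nat;
  fc_deg : forall p, 'I_(fc_rank p) -> nat;
  fc_diff : forall p, 'M[{mpoly F[n]}]_(fc_rank p.+1, fc_rank p);
  fc_aug : 'cV[{mpoly F[n]}]_(fc_rank 0) }.

Section Betti.
Variables (F : fieldType) (n : nat).
Implicit Types (C : free_complex F n) (J : {mpoly F[n]} -> Prop).

(* The differentials and the augmentation are homogeneous of degree 0. *)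
Definition fc_graded C : Prop :=
  (forall p i j m, m \in msupp (fc_diff C p i j) ->
     (mdeg m + fc_deg j)%N = fc_deg i) /\
  (forall i j m, m \in msupp (fc_aug C i j) -> mdeg m = fc_deg i).

Definition fc_resolves C J : Prop :=
  [/\ forall f, J f <-> exists u : 'rV_(fc_rank C 0), (u *m fc_aug C) 0 0 = f,
      forall u : 'rV_(fc_rank C 0),
        u *m fc_aug C = 0 <-> exists v, u = v *m fc_diff C 0
    & forall p (u : 'rV_(fc_rank C p.+1)),
        u *m fc_diff C p = 0 <-> exists v, u = v *m fc_diff C p.+1].

(* The image of each differential lies in (x_1, ..., x_n) times its target. *)
Definition fc_minimal C : Prop :=
  forall p i j, (fc_diff C p i j)@_0%MM = 0.

Definition minimal_graded_free_resolution C J : Prop :=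
  [/\ fc_graded C, fc_resolves C J & fc_minimal C].

Definition fc_betti C (p j : nat) : nat :=
  #|[set i : 'I_(fc_rank C p) | fc_deg i == j]|.

(* Minimal graded free resolutions of a homogeneous ideal exist and are unique
   up to graded isomorphism, so the chosen value does not depend on the choice
   of resolution. *)
Definition graded_betti J (p j : nat) : nat :=
  epsilon (inhabits 0%N) (fun b =>
    exists C, minimal_graded_free_resolution C J /\ b = fc_betti C p j).

End Betti.

(* The second binomial is 0 for i = 0, where ['C(0, 0 - 1)] would be 1. *)
Definition catalan (i : nat) : nat :=
  ('C(2 * i, i) - (if i is j.+1 then 'C(2 * i, j) else 0))%N.

(* The coefficient of t^r in (\sum_i C_i t^i)^k; only the terms of the series
   with i <= r contribute to it. *)
Definition catalan_pow (k r : nat) : nat :=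
  let q : {poly nat} := (\poly_(i < r.+1) catalan i) ^+ k in (q`_r)%R.

(* Main.v *)
Require Import Defs.
From mathcomp Require Import all_boot all_order all_algebra.
From mathcomp Require Import mpoly.
From mathcomp Require Import zify ring.
From Stdlib Require Import ClassicalEpsilon FunctionalExtensionality.

Set Implicit Arguments.
Unset Strict Implicit.
Unset Printing Implicit Defensive.

(* Read a squarefree monomial as a lattice path: step up at the variables that
   divide it, down at the others. A squarefree monomial lies in the initial
   ideal iff its path reaches height k. One direction: modulo I_{n,k} every
   squarefree polynomial reduces to monomials whose path stays below k (peel
   off the first variable). The other: every monomial staying below k is the
   smallest monomial in some functional that kills the multiples of
   (x_1 + ... + x_n)^k.
   So J_{n,k} is generated by the paths that reach k exactly at their last up
   step. By increasing degree, they have linear quotients: the colon ideal at a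
   generator of degree s is generated by the s - k variables at its down steps
   before it reaches k. Iterated mapping cones, which stay minimal for degree
   reasons, then give the Betti numbers, and the generators of degree s are
   counted by the ballot numbers, the coefficients of the powers of the Catalan
   series. *)

(** * Lattice paths and ballot numbers *)

(** [k] is the height still to climb: an up step lowers it by one, a down step raises it by one. *)
Fixpoint hits (k : nat) (s : bitseq) : bool :=
  if k is j.+1 then
    if s is b :: t then hits (if b then j else j.+2) t else false
  else true.

(** No up step may follow the hit, so these strings are the minimal ones among those that hit; they
    give the generators. *)
Fixpoint first_hit (k : nat) (s : bitseq) : bool :=
  if k is j.+1 then
    if s is b :: t then first_hit (if b then j else j.+2) t else false
  else ~~ has id s.

(* Marks the down steps taken before the path reaches height [k]. *)
Fixpoint down_steps (k : nat) (s : bitseq) : bitseq :=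
  if s is b :: t then
    if k is j.+1 then ~~ b :: down_steps (if b then j else j.+2) t
    else nseq (size s) false
  else [::].

Definition bits_le (s t : bitseq) := forall i, nth false s i -> nth false t i.

Lemma bits_le_cons b s t : bits_le s t -> bits_le (b :: s) (b :: t).
Proof. by move=> le_st [|i] //= /le_st. Qed.

Lemma bits_le0 m s : bits_le (nseq m false) s.
Proof. by move=> i; rewrite nth_nseq; case: ifP. Qed.

Lemma first_hit0 s : first_hit 0 s = (s == nseq (size s) false).
Proof.
rewrite [LHS](_ : _ = ~~ has id s); last by case: s.
by elim: s => //= -[] s IH //=; rewrite IH.
Qed.

Lemma down_steps0 s : down_steps 0 s = nseq (size s) false.
Proof. by case: s. Qed.

Lemma size_down_steps k s : size (down_steps k s) = size s.
Proof. by elim: s k => // b s IH [|k] //=; rewrite ?size_nseq ?IH. Qed.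

Lemma first_hit_hits k s : first_hit k s -> hits k s.
Proof. by elim: s k => [|b s IH] [|k] //= /IH. Qed.

(** Clear every bit after the first hit. *)
Lemma hits_first_hit k s : hits k s ->
  exists t, [/\ first_hit k t, size t = size s & bits_le t s].
Proof.
elim: s k => [|b s IH] [|k] //= hs.
- by exists [::]; split=> // i.
- exists (nseq (size s).+1 false); rewrite first_hit0 size_nseq eqxx.
  by split=> //; apply: bits_le0.
have [t [ft st le_ts]] := IH _ hs; exists (b :: t); split=> //=; first by rewrite st.
exact: bits_le_cons.
Qed.

(** At the first hit the up steps exceed the down steps by [k], and no up step comes later. *)
Lemma count_down_steps k s :
  first_hit k s -> count id s = k + count id (down_steps k s).
Proof.
elim: s k => [|b s IH] [|k] //.
  rewrite first_hit0 => /eqP->; rewrite down_steps0 size_nseq.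
  by rewrite count_nseq.
by move=> /= /IH->; case: b => //=; lia.
Qed.

Lemma down_steps_notin k s i : nth false (down_steps k s) i -> ~~ nth false s i.
Proof.
elim: s k i => [|b s IH] [|k] [|i] //=.
  by rewrite nth_nseq; case: ifP.
exact: IH.
Qed.

(** The path passes height [k] before [k.+1]; cutting it there drops at least one up step. *)
Lemma first_hit_lower k s : first_hit k.+1 s ->
  exists t, [/\ first_hit k t, size t = size s, bits_le t s
              & count id t < count id s].
Proof.
elim: s k => [|b s IH] [|k] //.
  move=> fs; exists (nseq (size (b :: s)) false).
  rewrite first_hit0 size_nseq eqxx; split=> //; first exact: bits_le0.
  by rewrite (count_down_steps fs) count_nseq.
case: b => /= /IH [t [ft st le_ts ct]]; [exists (true :: t)|exists (false :: t)].
  by split=> //=; [rewrite st | apply: bits_le_cons].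
by split=> //=; [rewrite st | apply: bits_le_cons].
Qed.

(** Turning the down step [i] into an up step brings the target two closer for the rest of the path.
    Lowering the target twice drops at least two up steps for the one gained, so the generator [t]
    has smaller degree and divides [s] times the variable [i]. *)
Lemma first_hit_add k s i : first_hit k s -> nth false (down_steps k s) i ->
  exists t, [/\ first_hit k t, size t = size s, count id t < count id s
              & forall j, nth false t j -> nth false s j \/ j = i].
Proof.
elim: s k i => [|b s IH] [|k] i //=; rewrite ?nth_nil //.
  by rewrite -[false :: _]/(nseq (size s).+1 false) nth_nseq; case: ifP.
case: i => [|i] /=.
  case: b => //= /first_hit_lower [t [/first_hit_lower [u [fu su le_ut cu]] st le_ts ct]] _.
  exists (true :: u) => /=; split=> //; [by rewrite su st | by lia | ].
  by move=> [|j] /=; [right | move/le_ut/le_ts; left].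
move=> /IH h /h [t [ft st ct le_ts]]; exists (b :: t).
split=> //=; [by rewrite st | by rewrite ltn_add2l | ].
by move=> [|j] /=; [left | move/le_ts=> [|->]; [left | right]].
Qed.

(* [2 * count id s - k] is the length of the path up to its first hit. *)
Lemma first_hit_diff k l s t : first_hit k s -> first_hit l t ->
  size s = size t -> k <= l -> (k, s) <> (l, t) ->
  2 * count id t + k <= 2 * count id s + l ->
  exists i, nth false (down_steps k s) i && nth false t i.
Proof.
elim: s t k l => [|b s IH] t k l.
  by case: t k l => [|//] [|k] [|l].
case: t => [//|c t]; case: k => [|k].
  rewrite first_hit0 => /eqP es ft [st] _; rewrite {}es count_nseq muln0 add0n addn0.
  have := count_down_steps ft => ct ne le2.
  case: l ft ct ne le2 => [|l] ft ct ne le2; last by lia.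
  by case: ne; congr (_, _); move: ft; rewrite first_hit0 => /eqP->; rewrite /= st.
case: l => [//|l] fs ft [st] le_kl ne le2.
(* Until a down step of [s] meets an up step of [t], the path of [s] stays at least as close to its
   target as that of [t]. As it hits no earlier, the two would otherwise coincide. *)
case: b c fs ft ne le2 => -[] /= fs ft ne le2.
- have [|||i hi] := IH t _ _ fs ft st; try lia.
    by move=> [ekl est]; apply: ne; rewrite ekl est.
  by exists i.+1.
- have [|||i hi] := IH t _ _ fs ft st; try lia.
    by move=> [ekl est]; lia.
  by exists i.+1.
- by exists 0.
- have [|||i hi] := IH t _ _ fs ft st; try lia.
    by move=> [ekl est]; apply: ne; rewrite ekl est.
  by exists i.+1.
Qed.

(** The number of paths that first reach height [k] after [r] down steps, by the first step taken.
    The down branch raises [k] while lowering [r], hence the nested fixpoints. *)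
Fixpoint ballot (r : nat) : nat -> nat :=
  if r is r'.+1 then
    fix row k := if k is k'.+1 then row k' + ballot r' k'.+2 else 0
  else fun _ => 1.

Lemma ballot0 r : ballot r.+1 0 = 0. Proof. by []. Qed.

Lemma ballotS r k : ballot r.+1 k.+1 = ballot r.+1 k + ballot r k.+2.
Proof. by []. Qed.

(** The reflection formula: Pascal's rule turns it into the recurrence of [ballot], by induction on
    [r] and then on [k]. *)
Lemma ballotE r k :
  ballot r k.+1 = 'C(2 * r + k, r) - (if r is q.+1 then 'C(2 * r + k, q) else 0).
Proof.
case: r => [|r]; first by rewrite bin0.
suff: ballot r.+1 k.+1 + 'C(2 * r.+1 + k, r) = 'C(2 * r.+1 + k, r.+1) by lia.
elim: r k => [|r IHr].
  by elim=> [|k IHk]; rewrite ballotS ?ballot0 /= !bin0 !bin1;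
    [|move: IHk; rewrite !bin0 !bin1 /=]; lia.
elim=> [|k IHk]; rewrite ballotS.
  have := IHr 1; have -> : 2 * r.+2 + 0 = (2 * r.+1 + 1).+1 by lia.
  (* For [k = 0] the up branch contributes nothing, and the two middle binomials of the odd row
     agree. *)
  have : 'C(2 * r.+1 + 1, r.+1) = 'C(2 * r.+1 + 1, r.+2).
    by rewrite -bin_sub; [congr 'C(_, _); lia | lia].
  by rewrite ballot0; move: (2 * r.+1 + 1) => N; rewrite !binS; lia.
have := IHr k.+2; have -> : 2 * r.+1 + k.+2 = 2 * r.+2 + k by lia.
have -> : 2 * r.+2 + k.+1 = (2 * r.+2 + k).+1 by lia.
by move: IHk; move: (2 * r.+2 + k) => N; rewrite !binS; lia.
Qed.

Lemma ballot_catalan r : ballot r 1 = catalan r.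
Proof. by rewrite ballotE addn0 /catalan; case: r. Qed.

(** Cut a path to height [a + b] at its first visit to height [a]. The measure [2 * r + a] drops
    along both branches of the recurrence. *)
Lemma ballotD r a b :
  ballot r (a + b) = \sum_(i < r.+1) ballot i a * ballot (r - i) b.
Proof.
have [m] := ubnP (2 * r + a); elim: m r a => // m IH r [|a] lt_m.
  by rewrite big_ord_recl /= subn0 mul1n big1 ?addn0.
case: r lt_m => [|r] lt_m; first by rewrite big_ord1.
rewrite addSn ballotS IH; last by lia.
rewrite -!addSn IH; last by lia.
rewrite !(big_ord_recl r.+1) /= -addnA; congr (_ + _).
rewrite -big_split /=; apply: eq_bigr => i _.
by rewrite /bump leq0n add1n subSS -mulnDl.
Qed.

Lemma catalan_powE k r : catalan_pow k r = ballot r k.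
Proof.
rewrite /catalan_pow; set P := (\poly_(i < _) _)%R.
(* Truncating the series after degree [r] keeps the coefficients up to [r]; each further factor is a
   convolution, by [ballotD] with [a = 1]. *)
suff: forall q, q <= r -> ((P ^+ k)`_q)%R = ballot q k by exact.
elim: k => [|k IH] q le_qr.
  by rewrite GRing.expr0 coef1; case: q le_qr.
rewrite GRing.exprS coefM (ballotD q 1 k); apply: eq_bigr => i _.
rewrite coef_poly ltnS (leq_trans _ le_qr) -1?ltnS // ballot_catalan IH //.
exact: leq_trans (leq_subr _ _) le_qr.
Qed.

(** * Counting bit strings by first hit and number of up steps *)

Fixpoint all_bits (n : nat) : seq bitseq :=
  if n is m.+1 then map (cons true) (all_bits m) ++ map (cons false) (all_bits m)
  else [:: [::]].

Lemma mem_all_bits n s : (s \in all_bits n) = (size s == n).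
Proof.
elim: n s => [|n IH] [|b s] //=; rewrite mem_cat.
  by apply/negbTE/norP; split; apply/negP=> /mapP [].
rewrite eqSS -IH; case: b; [rewrite orbC|]; rewrite mem_map; try by move=> ? ? [].
  by case: mapP => // -[].
by case: mapP => // -[].
Qed.

Lemma all_bits_uniq n : uniq (all_bits n).
Proof.
elim: n => //= n IH; rewrite cat_uniq !map_inj_uniq ?IH ?andbT; try by move=> s t [].
by apply/hasPn=> _ /mapP [s _ ->]; apply/negP=> /mapP [].
Qed.

Lemma count_all_bits n (P : pred bitseq) :
  count P (all_bits n.+1) = count (fun s => P (true :: s)) (all_bits n)
                          + count (fun s => P (false :: s)) (all_bits n).
Proof. by rewrite /= count_cat !count_map. Qed.

(** With [d] up steps the hit comes after [d - k] down steps, at time [2 * d - k], which has to fit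
    into [n]; the later bits are all false. *)
Lemma count_first_hit n k d :
  count (fun s => first_hit k s && (count id s == d)) (all_bits n) =
  if (k <= d) && (2 * d <= n + k) then ballot (d - k) k else 0.
Proof.
elim: n k d => [|n IH] [|k] d.
- by case: d.
- by case: ifP => //; lia.
- rewrite count_all_bits /= [X in X + _](eq_count (a2 := pred0)) // count_pred0.
  rewrite (eq_count (a2 := fun s => first_hit 0 s && (count id s == d))); last first.
    by case.
  rewrite IH; case: d => [|d]; first by [].
  by rewrite subn0 ballot0 !if_same.
rewrite count_all_bits /= IH.
rewrite (eq_count (a2 := fun s => (0 < d) && (first_hit k s && (count id s == d.-1)))); last first.
  by move=> s; case: d => [|d] /=; rewrite ?andbF // add1n eqSS.
case: d => [|d]; first by rewrite (eq_count (a2 := pred0)) ?count_pred0.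
rewrite /= IH !subSS; case: ifP => h1; case: ifP => h2; case: ifP => h3; try lia.
  have [r e] : exists r, d - k = r.+1 by exists (d - k.+1); lia.
  by rewrite e ballotS subnS e.
have -> : k = d by lia.
by rewrite subnn.
Qed.

(** * Minimal graded free resolutions *)

(** Liftings exist one degree at a time, each depending on the one before; this assembles them into
    a chain map. *)
Lemma dependent_choice (T : nat -> Type) (P : forall p, T p -> Prop)
    (Q : forall p, T p -> T p.+1 -> Prop) (x0 : T 0) :
  P 0 x0 -> (forall p x, P p x -> exists y, Q p x y /\ P p.+1 y) ->
  exists f : forall p, T p, f 0 = x0 /\ forall p, P p (f p) /\ Q p (f p) (f p.+1).
Proof.
move=> P0 step.
pose next p (x : {x | P p x}) :=
  constructive_indefinite_description _ (step p (sval x) (svalP x)).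
pose g := fix g p : {x | P p x} :=
  if p is q.+1 return {x | P p x}
  then exist _ (sval (next q (g q))) (proj2 (svalP (next q (g q))))
  else exist _ x0 P0.
exists (fun p => sval (g p)); split=> // p; split; first exact: svalP.
exact: (proj1 (svalP (next p (g p)))).
Qed.

(** * Homogeneous maps between graded free modules *)

Section GradedMatrices.
Local Open Scope ring_scope.
Import GRing.Theory.
Variables (F : fieldType) (n : nat).
Local Notation R := {mpoly F[n]}.

Definition graded_mx (a b : nat) (e : 'I_a -> nat) (e' : 'I_b -> nat)
    (M : 'M[R]_(a, b)) :=
  forall i j m, m \in msupp (M i j) -> (mdeg m + e' j)%N = e i.

(** The homogeneous component of degree [a - b], written additively to avoid truncated
    subtraction. *)
Definition degree_part (a b : nat) (q : R) : R :=
  \sum_(m <- msupp q | mdeg m + b == a) q@_m *: 'X_[m].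

Lemma mcoeff_degree_part a b q m :
  (degree_part a b q)@_m = q@_m *+ (mdeg m + b == a)%N.
Proof.
rewrite /degree_part raddf_sum /= big_mkcond /=.
transitivity (\sum_(m' <- msupp q) (q@_m' *: 'X_[m'] : R)@_m *+ (mdeg m + b == a)%N).
  apply: eq_bigr => m' _; rewrite mcoeffZ mcoeffX.
  by case: (eqVneq m' m) => [->|_]; case: ifP; rewrite ?mulr0 ?mul0rn ?mulr1n ?mulr0n.
by rewrite sumrMnl -raddf_sum /= -mpolyE.
Qed.

Lemma degree_part_id a b q :
  (forall m, m \in msupp q -> (mdeg m + b)%N = a) -> degree_part a b q = q.
Proof.
move=> hq; apply/mpolyP => m; rewrite mcoeff_degree_part.
case: (boolP (m \in msupp q)) => [/hq->|]; first by rewrite eqxx.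
by rewrite -mcoeff_eq0 => /eqP->; rewrite mul0rn.
Qed.

Lemma degree_part_sum (I : finType) a b (f : I -> R) :
  degree_part a b (\sum_i f i) = \sum_i degree_part a b (f i).
Proof.
apply/mpolyP => m; rewrite mcoeff_degree_part !raddf_sum /= -sumrMnl.
by apply: eq_bigr => i _; rewrite mcoeff_degree_part.
Qed.

Lemma degree_partM a b c p q :
  (forall m, m \in msupp q -> (mdeg m + b)%N = c) ->
  degree_part a b (p * q) = degree_part a c p * q.
Proof.
move=> hq; apply/mpolyP => m; rewrite mcoeff_degree_part !mcoeffM -sumrMnl.
apply: eq_bigr => -[k1 k2] /= /eqP em.
rewrite mcoeff_degree_part mulrnAl; move: (bmnm k1) (bmnm k2) em => m1 m2 ->.
rewrite mdegD.
case: (boolP (m2 \in msupp q)) => [/hq <-|]; first by rewrite addnA.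
by rewrite -mcoeff_eq0 => /eqP->; rewrite mulr0 !mul0rn.
Qed.

Lemma lift_mx a b c (d : 'M[R]_(b, c)) (M : 'M[R]_(a, c)) :
  (forall i, exists v : 'rV_b, row i M = v *m d) -> exists N, M = N *m d.
Proof.
move=> /fin_all_exists [v hv]; exists (\matrix_i v i).
by apply/row_matrixP => i; rewrite hv row_mul rowK.
Qed.

(** Any lift of a homogeneous map becomes homogeneous when each entry is replaced by its component
    of the right degree. *)
Lemma lift_graded_mx a b c (e : 'I_a -> nat) (e' : 'I_b -> nat)
    (e'' : 'I_c -> nat) (d : 'M[R]_(b, c)) (M : 'M[R]_(a, c)) :
  graded_mx e' e'' d -> graded_mx e e'' M ->
  (forall i, exists v : 'rV_b, row i M = v *m d) ->
  exists N, graded_mx e e' N /\ M = N *m d.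
Proof.
move=> hd hM /lift_mx [N eM].
exists (\matrix_(i, j) degree_part (e i) (e' j) (N i j)); split.
  move=> i j m; rewrite mxE mcoeff_msupp mcoeff_degree_part.
  by case: (eqVneq (mdeg m + e' j)%N (e i)) => // _; rewrite mulr0n eqxx.
apply/matrixP => i j; rewrite -(degree_part_id (hM i j)) {1}eM !mxE degree_part_sum.
by apply: eq_bigr => l _; rewrite mxE; apply/degree_partM/hd.
Qed.

Lemma graded_mxN a b (e : 'I_a -> nat) (e' : 'I_b -> nat) (M : 'M[R]_(a, b)) :
  graded_mx e e' M -> graded_mx e e' (- M).
Proof. by move=> hM i j m; rewrite mxE (perm_mem (msuppN _)); apply: hM. Qed.

Lemma graded_mxM a b c (e : 'I_a -> nat) (e' : 'I_b -> nat) (e'' : 'I_c -> nat)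
    (M : 'M[R]_(a, b)) (N : 'M[R]_(b, c)) :
  graded_mx e e' M -> graded_mx e' e'' N -> graded_mx e e'' (M *m N).
Proof.
move=> hM hN i j m.
have -> : (M *m N) i j = degree_part (e i) (e'' j) ((M *m N) i j).
  rewrite mxE degree_part_sum; apply: eq_bigr => l _.
  by rewrite (degree_partM _ _ (hN l j)) (degree_part_id (hM i l)).
rewrite mcoeff_msupp mcoeff_degree_part.
by case: (eqVneq (mdeg m + e'' j)%N (e i)) => // _; rewrite mulr0n eqxx.
Qed.

Lemma mxE0P a b (M : 'M[R]_(a, b)) : (forall u : 'rV_a, u *m M = 0) -> M = 0.
Proof. by move=> h; apply/row_matrixP => i; rewrite rowE h row0. Qed.

End GradedMatrices.

Section Complexes.
Local Open Scope ring_scope.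
Import GRing.Theory.
Variables (F : fieldType) (n : nat).
Local Notation R := {mpoly F[n]}.
Implicit Types (C K : free_complex F n) (J : R -> Prop).

(** * Comparison of resolutions and uniqueness of Betti numbers *)

Lemma fc_diff_aug C J : fc_resolves C J -> fc_diff C 0 *m fc_aug C = 0.
Proof.
by case=> _ h _; apply: mxE0P => u; rewrite mulmxA; apply/h; exists u.
Qed.

Lemma fc_diff_diff C J p : fc_resolves C J -> fc_diff C p.+1 *m fc_diff C p = 0.
Proof.
by case=> _ _ h; apply: mxE0P => u; rewrite mulmxA; apply/h; exists u.
Qed.

Lemma exact_row0 C J a (M : 'M[R]_(a, fc_rank C 0)) : fc_resolves C J ->
  M *m fc_aug C = 0 -> forall i, exists v : 'rV_(fc_rank C 1), row i M = v *m fc_diff C 0.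
Proof. by case=> _ h _ hM i; apply/h; rewrite -row_mul hM row0. Qed.

Lemma exact_rowS C J p a (M : 'M[R]_(a, fc_rank C p.+1)) : fc_resolves C J ->
  M *m fc_diff C p = 0 ->
  forall i, exists v : 'rV_(fc_rank C p.+2), row i M = v *m fc_diff C p.+1.
Proof. by case=> _ _ h hM i; apply/h; rewrite -row_mul hM row0. Qed.

Lemma lift_aug C J a (e : 'I_a -> nat) (M : 'cV[R]_a) :
  fc_graded C -> fc_resolves C J ->
  (forall i m, m \in msupp (M i 0) -> mdeg m = e i) -> (forall i, J (M i 0)) ->
  exists N, graded_mx e (@fc_deg F n C 0) N /\ M = N *m fc_aug C.
Proof.
move=> [_ gC] [resJ _ _] gM JM.
apply: (@lift_graded_mx _ _ _ _ _ _ _ (fun _ => 0%N)).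
- by move=> i j m /gC; rewrite addn0.
- by move=> i j m; rewrite ord1 addn0; apply: gM.
move=> i; have [u hu] := (resJ _).1 (JM i); exists u.
by apply/matrixP => x y; rewrite !ord1 hu mxE.
Qed.

(** The comparison theorem, with any complex of graded free modules as source. It serves both for
    two resolutions of one ideal and for the connecting map of a mapping cone. *)
Lemma lift_chain C J (a : nat -> nat) (e : forall p, 'I_(a p) -> nat)
    (d : forall p, 'M[R]_(a p.+1, a p)) (N0 : 'M[R]_(a 0%N, fc_rank C 0)) :
  fc_graded C -> fc_resolves C J ->
  (forall p, graded_mx (@e p.+1) (@e p) (d p)) -> (forall p, d p.+1 *m d p = 0) ->
  graded_mx (@e 0%N) (@fc_deg F n C 0) N0 -> d 0%N *m N0 *m fc_aug C = 0 ->
  exists N : forall p, 'M[R]_(a p, fc_rank C p),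
    [/\ N 0%N = N0, forall p, graded_mx (@e p) (@fc_deg F n C p) (N p)
      & forall p, d p *m N p = N p.+1 *m fc_diff C p].
Proof.
move=> gC rC gd dd gN0 dN0.
pose P p (N : 'M[R]_(a p, fc_rank C p)) := graded_mx (@e p) (@fc_deg F n C p) N /\
  forall i, exists v : 'rV_(fc_rank C p.+1), row i (d p *m N) = v *m fc_diff C p.
pose Q p (N : 'M[R]_(a p, fc_rank C p)) (N' : 'M[R]_(a p.+1, fc_rank C p.+1)) :=
  d p *m N = N' *m fc_diff C p.
have [||N [hN0 hN]] := @dependent_choice _ P Q N0.
- by split=> //; apply: exact_row0 dN0; exact: rC.
- move=> p N [gN exN].
  have [N' [gN' eN']] := lift_graded_mx (gC.1 p) (graded_mxM (gd p) gN) exN.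
  exists N'; split=> //; split=> //; apply: (exact_rowS rC).
  by rewrite -mulmxA -eN' mulmxA dd mul0mx.
by exists N; split=> // p; case: (hN p) => [[]].
Qed.

(** A chain endomorphism over the zero map is null homotopic, of the form [d h + h' d]; the
    differentials vanish modulo the variables, hence so does it. *)
Lemma minimal_null_homotopy C J (E : forall p, 'M[R]_(fc_rank C p)) :
  fc_resolves C J -> fc_minimal C -> E 0%N *m fc_aug C = 0 ->
  (forall p, fc_diff C p *m E p = E p.+1 *m fc_diff C p) ->
  forall p, map_mx (mcoeff 0%MM) (E p) = 0.
Proof.
move=> rC mC E0 dE.
have dC0 p : map_mx (mcoeff 0%MM) (fc_diff C p) = 0.
  by apply/matrixP => i j; rewrite !mxE mC.
(* The induction keeps only what the next stage needs: this equation makes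
   [E p.+1 - fc_diff C p *m h] liftable. *)
suff H p : (exists h, fc_diff C p *m (E p - h *m fc_diff C p) = 0) /\
    map_mx (mcoeff 0%MM) (E p) = 0 by move=> p; case: (H p).
elim: p => [|p [[h hh] _]].
  have [h eh] := lift_mx (exact_row0 rC E0).
  by split; [exists h; rewrite eh subrr mulmx0 | rewrite eh map_mxM dC0 mulmx0].
have [h' eh'] : exists h', E p.+1 - fc_diff C p *m h = h' *m fc_diff C p.+1.
  apply/lift_mx/(exact_rowS rC).
  by rewrite mulmxBl -dE -mulmxA -mulmxBr hh.
have {}eh' : E p.+1 = fc_diff C p *m h + h' *m fc_diff C p.+1.
  by rewrite -eh' addrC subrK.
split; last by rewrite eh' map_mxD !map_mxM !dC0 mul0mx mulmx0 addr0.
by exists h'; rewrite eh' addrK mulmxA (fc_diff_diff _ rC) mul0mx.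
Qed.

Lemma comparison_exists C C' J : minimal_graded_free_resolution C J ->
  minimal_graded_free_resolution C' J ->
  exists f : forall p, 'M[R]_(fc_rank C p, fc_rank C' p),
  [/\ f 0%N *m fc_aug C' = fc_aug C,
      forall p, graded_mx (@fc_deg F n C p) (@fc_deg F n C' p) (f p)
    & forall p, fc_diff C p *m f p = f p.+1 *m fc_diff C' p].
Proof.
move=> [gC rC mC] [gC' rC' mC'].
have [||N0 [gN0 eN0]] := @lift_aug C' J _ (@fc_deg F n C 0) (fc_aug C) gC' rC'.
- by move=> i m /gC.2.
- move=> i; case: rC => rC _ _; apply/rC; exists (delta_mx 0 i).
  by rewrite -rowE mxE.
have [|||f [f0 gf df]] :=
  @lift_chain C' J (fc_rank C) (@fc_deg F n C) (fc_diff C) N0 gC' rC' _ _ gN0.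
- exact: gC.1.
- by move=> p; apply: fc_diff_diff rC.
- by rewrite -mulmxA -eN0 (fc_diff_aug rC).
by exists f; rewrite f0.
Qed.

(** [f p *m g p - 1] lifts the zero map, so its constant terms vanish by minimality. *)
Lemma comparison_inverse C C' J
    (f : forall p, 'M[R]_(fc_rank C p, fc_rank C' p))
    (g : forall p, 'M[R]_(fc_rank C' p, fc_rank C p)) :
  fc_resolves C J -> fc_minimal C ->
  f 0%N *m fc_aug C' = fc_aug C -> g 0%N *m fc_aug C = fc_aug C' ->
  (forall p, fc_diff C p *m f p = f p.+1 *m fc_diff C' p) ->
  (forall p, fc_diff C' p *m g p = g p.+1 *m fc_diff C p) ->
  forall p, map_mx (mcoeff 0%MM) (f p) *m map_mx (mcoeff 0%MM) (g p) = 1%:M.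
Proof.
move=> rC mC f0 g0 df dg p.
have := @minimal_null_homotopy C J (fun p => f p *m g p - 1%:M) rC mC _ _ p.
rewrite map_mxB map_mxM map_mx1 => h; apply/subr0_eq/h.
  by rewrite mulmxBl -mulmxA g0 f0 mul1mx subrr.
by move=> q; rewrite mulmxBr mulmxBl mulmxA df -!mulmxA dg mulmx1 mul1mx.
Qed.

Lemma natr_inj_pchar0 (a b : nat) : [pchar F] =i pred0 -> a%:R = b%:R :> F -> a = b.
Proof.
move=> /pcharf0P hF; wlog le_ab : a b / (a <= b)%N.
  by move=> wl h; case/orP: (leq_total a b) => /wl -> //; rewrite h.
move=> h; have : (b - a)%:R == 0 :> F by rewrite natrB // h subrr.
by rewrite hF subn_eq0 => le_ba; apply/eqP; rewrite eqn_leq le_ab.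
Qed.

(* Both counts are the trace of the part of an invertible degree-preserving
   matrix that sits in degree [j]. *)
Lemma graded_rank_unique a b (e : 'I_a -> nat) (e' : 'I_b -> nat)
    (P : 'M[F]_(a, b)) (Q : 'M[F]_(b, a)) j :
  [pchar F] =i pred0 -> (forall i l, P i l != 0 -> e i = e' l) ->
  P *m Q = 1%:M -> Q *m P = 1%:M ->
  #|[set i | e i == j]| = #|[set i | e' i == j]|.
Proof.
move=> hF eP PQ QP; apply: (natr_inj_pchar0 hF).
rewrite -!sum1_card !natr_sum ![\sum_(i in _) _]big_mkcond /=.
transitivity (\sum_i \sum_l (P i l * Q l i) *+ (e i == j)).
  apply: eq_bigr => i _; rewrite inE.
  have := congr1 (fun M => fun_of_matrix M i i) PQ.
  by rewrite !mxE eqxx /= => <-; case: eqP; rewrite ?sumrMnl ?mulr1n ?mulr0n.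
rewrite exchange_big; apply: eq_bigr => l _; rewrite inE.
have := congr1 (fun M => fun_of_matrix M l l) QP.
rewrite !mxE eqxx /= => <-.
transitivity (\sum_i (Q l i * P i l) *+ (e' l == j)).
  apply: eq_bigr => i _; rewrite mulrC.
  by have [->|/eP->//] := eqVneq (P i l) 0; rewrite mulr0 !mul0rn.
by case: eqP => _; rewrite ?mulr1n // ?mulr0n big1.
Qed.

Lemma fc_betti_unique C C' J p j : [pchar F] =i pred0 ->
  minimal_graded_free_resolution C J -> minimal_graded_free_resolution C' J ->
  fc_betti C p j = fc_betti C' p j.
Proof.
move=> hF hC hC'.
have [f [f0 gf df]] := comparison_exists hC hC'.
have [g [g0 gg dg]] := comparison_exists hC' hC.
case: hC hC' => [gC rC mC] [gC' rC' mC'].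
apply: (graded_rank_unique _ hF _ (comparison_inverse rC mC f0 g0 df dg p)
  (comparison_inverse rC' mC' g0 f0 dg df p)).
move=> i l; rewrite mxE -mcoeff_msupp => /gf.
by rewrite mdeg0.
Qed.

Definition has_betti J (b : nat -> nat -> nat) :=
  exists C, minimal_graded_free_resolution C J /\ forall p j, fc_betti C p j = b p j.

Lemma graded_bettiE J b p j : [pchar F] =i pred0 -> has_betti J b ->
  graded_betti J p j = b p j.
Proof.
move=> hF [C [hC bC]]; rewrite /graded_betti.
have := @epsilon_spec _ (inhabits 0%N)
  (fun b => exists C, minimal_graded_free_resolution C J /\ b = fc_betti C p j)
  (ex_intro _ (fc_betti C p j) (ex_intro _ C (conj hC erefl))).
case=> C' [hC' ->]; rewrite -bC; apply: fc_betti_unique hF hC' hC.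
Qed.

Lemma has_betti_ext J J' b b' : (forall g, J g <-> J' g) ->
  (forall p j, b p j = b' p j) -> has_betti J b -> has_betti J' b'.
Proof.
move=> eJ eb [C [[gC [r0 r1 r2] mC] bC]]; exists C; split.
  by split=> //; split=> // g; rewrite -r0; split=> /eJ.
by move=> p j; rewrite bC.
Qed.

(** * Mapping cones *)

Definition zero_complex : free_complex F n :=
  @FreeComplex F n (fun _ => 0%N) (fun _ _ => 0%N) (fun _ => 0) 0.

Lemma has_betti0 : has_betti (fun g => g = 0) (fun _ _ => 0%N).
Proof.
exists zero_complex; split; last by move=> p j; apply: eq_card0 => -[].
split; [split | split | ].
- by move=> p [].
- by move=> [].
- move=> f; split=> [->|[u]]; first by exists 0; rewrite mul0mx mxE.
  by rewrite mulmx0 mxE => <-.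
- by move=> u; split=> _; [exists 0; apply/matrixP => x []|apply/matrixP => x []; rewrite mulmx0].
- by move=> p u; split=> _; [exists 0; apply/matrixP => x []|apply/matrixP => x []].
by move=> p [].
Qed.

Section Cone.
Variables (C K : free_complex F n) (f : R) (d : nat).

(** When [K] resolves an ideal, a free module of rank one put below it, with [fc_aug K] as first
    map, yields a resolution of the quotient ring, here with degrees shifted by [d]. *)
Definition cone_rank p := if p is q.+1 then fc_rank K q else 1%N.

Definition cone_deg p : 'I_(cone_rank p) -> nat :=
  match p with 0 => fun=> d | q.+1 => fun i => (fc_deg i + d)%N end.

Definition cone_diff p : 'M[R]_(cone_rank p.+1, cone_rank p) :=
  match p with 0 => fc_aug K | q.+1 => fc_diff K q end.

Definition cone (N : forall p, 'M[R]_(cone_rank p.+1, fc_rank C p)) :=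
  @FreeComplex F n (fun p => fc_rank C p + cone_rank p)%N
    (fun p i => match split i with inl l => fc_deg l | inr l => cone_deg l end)
    (fun p => block_mx (fc_diff C p) 0 (N p) (cone_diff p))
    (col_mx (fc_aug C) f%:M).

End Cone.

Lemma fc_betti_eq0 C p j i : fc_betti C p j = 0%N -> @fc_deg F n C p i <> j.
Proof.
by move=> /eqP; rewrite cards_eq0 => /eqP/setP/(_ i); rewrite !inE => /eqP.
Qed.

Lemma fc_bettiE C p j : fc_betti C p j = (\sum_i (@fc_deg F n C p i == j))%N.
Proof.
rewrite /fc_betti -sum1_card big_mkcond /=; apply: eq_bigr => i _.
by rewrite inE; case: eqP.
Qed.

Lemma mapping_cone J J' J'' b b' f d :
  has_betti J b -> has_betti J'' b' ->
  (forall m, m \in msupp f -> mdeg m = d) ->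
  (forall g, J'' g <-> J (g * f)) ->
  (forall g, J' g <-> exists x y, J x /\ g = x + y * f) ->
  (forall p j, (p + d < j)%N -> b p j = 0%N) ->
  (forall p j, (j <= p)%N -> b' p j = 0%N) ->
  has_betti J' (fun p j => b p j +
    if p is q.+1 then if (d <= j)%N then b' q (j - d)%N else 0 else (j == d))%N.
Proof.
move=> [C [[gC rC mC] bC]] [K [[gK rK mK] bK]] hf colon sumJ bnd bnd'.
have degC p (i : 'I_(fc_rank C p)) : (fc_deg i <= p + d)%N.
  by rewrite leqNgt; apply/negP => /bnd; rewrite -bC => /fc_betti_eq0; apply.
have degK p (i : 'I_(fc_rank K p)) : (p < fc_deg i)%N.
  by rewrite ltnNge; apply/negP => /bnd'; rewrite -bK => /fc_betti_eq0; apply.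
have gaugK : graded_mx (@fc_deg F n K 0) (fun _ => 0%N) (fc_aug K).
  by move=> i j m /gK.2; rewrite addn0.
(* [N0] lifts minus the multiplication by [f], so that the two summands cancel in the augmentation;
   the sign on the differentials below likewise makes the squares anticommute. *)
have [||N0 [gN0 eN0]] := @lift_aug C J _ (fun i => fc_deg i + d)%N (- (fc_aug K *m f%:M)) gC rC.
- move=> i m; rewrite mxE (perm_mem (msuppN _)) mul_mx_scalar mxE.
  move=> /msuppM_le /allpairsP [[m1 m2] /= [/hf h1 /gK.2 h2 ->]].
  by rewrite mdegD h1 h2 addnC.
- move=> i; rewrite mxE mul_mx_scalar mxE mulrC.
  have : J'' (fc_aug K i 0).
    case: rK => rK _ _; apply/rK; exists (delta_mx 0 i).
    by rewrite -rowE mxE.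
  move=> /colon; case: rC => rC _ _ /rC [u hu]; apply/rC; exists (- u).
  by rewrite mulNmx mxE hu.
have [|||N [eN gN dN]] := @lift_chain C J (fun p => cone_rank K p.+1)
  (fun p => @cone_deg K d p.+1) (fun p => - cone_diff K p.+1) N0 gC rC _ _ gN0.
- by move=> p; apply: graded_mxN => i j m /= /gK.1; lia.
- by move=> p; rewrite mulNmx mulmxN opprK; apply: fc_diff_diff rK.
- by rewrite -mulmxA -eN0 mulmxN mulNmx opprK mulmxA (fc_diff_aug rK) mul0mx.
have kk p : cone_diff K p.+1 *m cone_diff K p = 0.
  by case: p => [|p]; [apply: fc_diff_aug rK | apply: fc_diff_diff rK].
have exK p (u : 'rV_(cone_rank K p.+1)) : u *m cone_diff K p = 0 ->
    exists v, u = v *m cone_diff K p.+1.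
  by case: p u => [|p] u; case: rK => _ h0 hS; [move/h0 | move/hS].
have sq0 : block_mx (fc_diff C 0) 0 (N 0%N) (cone_diff K 0) *m
    col_mx (fc_aug C) f%:M = 0.
  rewrite mul_block_col mul0mx addr0 (fc_diff_aug rC) eN -eN0 /= addNr.
  exact: col_mx0.
have sqS p : block_mx (fc_diff C p.+1) 0 (N p.+1) (cone_diff K p.+1) *m
    block_mx (fc_diff C p) 0 (N p) (cone_diff K p) = 0.
  rewrite mulmx_block !mulmx0 !mul0mx !addr0 add0r (fc_diff_diff _ rC) kk -dN.
  by rewrite mulNmx addNr block_mx0.
exists (@cone C K f d N); split; first split.
- split=> [p i j m | i j m].
    rewrite /= /block_mx !mxE; case: (split i) => i'; rewrite mxE; case: (split j) => j'.
    + exact: gC.1.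
    + by rewrite mxE mcoeff_msupp mcoeff0 eqxx.
    + exact: gN.
    + by case: p i i' j j' => [|p] i i' j j' /=; [move/gK.2=> -> | move/gK.1; lia].
  rewrite /= mxE; case: (split i) => i'; first exact: gC.2.
  by rewrite mxE !ord1 eqxx mulr1n => /hf.
- case: (rC) (rK) => C0 C1 CS [K0 K1 KS]; split.
  + move=> g; rewrite sumJ; split=> [[x [y [/C0 [u hu] ->]]] | [u <-]].
      by exists (row_mx u y%:M); rewrite mul_row_col mxE hu -scalar_mxM mxE eqxx mulr1n.
    rewrite -(hsubmxK u) mul_row_col mxE.
    exists ((lsubmx u *m fc_aug C) 0 0), (rsubmx u 0 0); split.
      by apply/C0; exists (lsubmx u).
    by rewrite mul_mx_scalar [X in _ + X = _]mxE [f * _]mulrC.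
  + move=> u; split=> [|[v ->]]; last by rewrite -mulmxA sq0 mulmx0.
    rewrite -(hsubmxK u) mul_row_col; move: (lsubmx u) (rsubmx u) => c y e0.
    (* A relation between a member of [J] and [y] times [f] puts [y] in the colon ideal; lifting [y]
       to [K] leaves a relation in [C] alone. *)
    have [v ev] : exists v, y = v *m fc_aug K.
      have /K0 [v hv] : J'' (y 0 0).
        apply/colon/C0; exists (- c); rewrite mulNmx.
        have := congr1 (fun M => fun_of_matrix M 0 0) e0; rewrite !mxE => /eqP.
        by rewrite addrC addr_eq0 => /eqP <-; rewrite big_ord1 !mxE eqxx mulr1n.
      by exists v; apply/matrixP => i l; rewrite !ord1.
    have /C1 [w hw] : (c - v *m N 0%N) *m fc_aug C = 0.
      by rewrite mulmxBl -mulmxA eN -eN0 mulmxN opprK mulmxA -ev.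
    exists (row_mx w v); rewrite mul_row_block mulmx0 add0r -hw subrK.
    by rewrite /= -ev.
  + move=> p u; split=> [|[v ->]]; last by rewrite -mulmxA sqS mulmx0.
    rewrite -(hsubmxK u) mul_row_block mulmx0 add0r.
    move: (lsubmx u) (rsubmx u) => c y.
    rewrite -[0](row_mx0 _) => /eq_row_mx [e0 /exK [v ev]].
    have /CS [w hw] : (c - v *m N p.+1) *m fc_diff C p = 0.
      by rewrite mulmxBl -mulmxA -dN mulNmx mulmxN opprK mulmxA -ev.
    exists (row_mx w v); rewrite mul_row_block mulmx0 add0r -hw subrK.
    by rewrite -ev.
- move=> p i j; rewrite /= /block_mx !mxE; case: (split i) => i'; rewrite mxE.
    by case: (split j) => j'; [exact: mC | rewrite mxE mcoeff0].
  case: (split j) => j'.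
    (* Rows have degree above [p + d] and columns at most [p + d], so the entries of [N p] have no
       constant term. *)
    apply/eqP; rewrite mcoeff_eq0; apply/negP => /gN /=.
    by rewrite mdeg0; have := degC p j'; have := degK p i'; lia.
  case: p i i' j j' => [|p] i i' j j' /=; last exact: mK.
  apply/eqP; rewrite mcoeff_eq0; apply/negP => /gK.2.
  by rewrite mdeg0; have := degK 0%N i'; lia.
move=> p j; rewrite fc_bettiE big_split_ord /= -bC fc_bettiE; congr (_ + _)%N.
  by apply: eq_bigr => i _; rewrite (unsplitK (inl i)).
transitivity (\sum_(i < cone_rank K p) (@cone_deg K d p i == j))%N.
  by apply: eq_bigr => i _; rewrite (unsplitK (inr i)).
case: p => [|p] /=; first by rewrite big_ord1 eq_sym.
case: leqP => [le_dj | lt_jd].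
  by rewrite -bK fc_bettiE; apply: eq_bigr => i _; congr (nat_of_bool _); lia.
by rewrite big1 // => i _; case: eqP => //; lia.
Qed.

End Complexes.

(** * Monomial ideals with linear quotients *)

Section MonomialIdeals.
Local Open Scope ring_scope.
Import GRing.Theory.
Variables (F : fieldType) (n : nat).
Local Notation R := {mpoly F[n]}.
Implicit Types (M : 'X_{1..n} -> Prop) (S : R -> Prop).

(** The ideal generated by the monomials of [M], seen through supports, which makes colons by a
    monomial combinatorial. *)
Definition monomial_ideal M (g : R) :=
  forall m, m \in msupp g -> exists2 m0, M m0 & (m0 <= m)%MM.

Lemma ideal_gen0 S : ideal_gen S 0.
Proof. by exists [::]; rewrite big_nil. Qed.

Lemma ideal_genD S f g : ideal_gen S f -> ideal_gen S g -> ideal_gen S (f + g).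
Proof.
move=> [l [hl ->]] [l' [hl' ->]]; exists (l ++ l'); rewrite big_cat; split=> //.
by move=> x; rewrite mem_cat => /orP [/hl | /hl'].
Qed.

Lemma ideal_genM S f g : ideal_gen S f -> ideal_gen S (g * f).
Proof.
move=> [l [hl ->]]; exists [seq (g * x.1, x.2) | x <- l]; split.
  by move=> _ /mapP [x /hl hx ->].
by rewrite big_map mulr_sumr; apply: eq_bigr => x _; rewrite mulrA.
Qed.

Lemma ideal_gen_mem S f : S f -> ideal_gen S f.
Proof.
move=> Sf; exists [:: (1, f)]; rewrite big_seq1 mul1r; split=> // x.
by rewrite inE => /eqP->.
Qed.

Lemma ideal_gen_sum S (I : Type) (r : seq I) (P : pred I) (f : I -> R) :
  (forall i, P i -> ideal_gen S (f i)) -> ideal_gen S (\sum_(i <- r | P i) f i).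
Proof.
by move=> h; apply: big_ind => //; [apply: ideal_gen0 | apply: ideal_genD].
Qed.

Lemma ideal_gen_sub S S' f : (forall g, S g -> ideal_gen S' g) ->
  ideal_gen S f -> ideal_gen S' f.
Proof.
move=> h [l [hl ->]]; rewrite big_seq; apply: ideal_gen_sum => x /hl /h.
exact: ideal_genM.
Qed.

Lemma mem_msuppMX (g : R) m m' :
  (m' \in msupp (g * 'X_[m])) -> exists2 m1, m1 \in msupp g & m' = (m + m1)%MM.
Proof. by rewrite (perm_mem (msuppMX _ _)) => /mapP. Qed.

Lemma ideal_gen_monomials M f :
  ideal_gen (fun g => exists m, M m /\ g = 'X_[m]) f <-> monomial_ideal M f.
Proof.
split=> [[l [hl ->]] m | hf].
  move=> /msupp_sum_le/flattenP [_ /mapP [x + ->]]; rewrite mem_filter /= => lx.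
  have [m0 [Mm0 ->]] := hl x lx.
  by case/mem_msuppMX=> m1 _ ->; exists m0 => //; apply: lem_addr.
rewrite [f]mpolyE big_seq; apply: ideal_gen_sum => m /hf [m0 Mm0 le_m].
rewrite -(submK le_m) mpolyXD scalerAl; apply: ideal_genM.
by apply: ideal_gen_mem; exists m0.
Qed.

Lemma monomial_ideal_sub M M' f : (forall m, M m -> exists2 m0, M' m0 & (m0 <= m)%MM) ->
  monomial_ideal M f -> monomial_ideal M' f.
Proof.
move=> h hf m /hf [m1 /h [m2 Mm2 le21] le1]; exists m2 => //.
exact: lepm_trans le21 le1.
Qed.

Lemma monomial_ideal_add M m0 g :
  monomial_ideal (fun m => M m \/ m = m0) g <->
  exists x y, monomial_ideal M x /\ g = x + y * 'X_[m0].
Proof.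
split=> [hg | [x [y [hx ->]]] m].
  exists (\sum_(m <- msupp g | ~~ (m0 <= m)%MM) g@_m *: 'X_[m]).
  exists (\sum_(m <- msupp g | (m0 <= m)%MM) g@_m *: 'X_[m - m0]); split.
    move=> m /msupp_sum_le /flattenP [_ /mapP [m1 + ->]].
    rewrite mem_filter => /andP [nle m1g] /msuppZ_le; rewrite msuppX inE => /eqP ->.
    have [m2 [Mm2|->] le2] := hg _ m1g; first by exists m2.
    by rewrite le2 in nle.
  rewrite mulr_suml {1}[g]mpolyE (bigID (fun m => (m0 <= m)%MM)) /= addrC.
  congr (_ + _); apply: eq_bigr => m le_m.
  by rewrite -scalerAl -mpolyXD submK.
move/msuppD_le; rewrite mem_cat => /orP [/hx [m1 Mm1 le1] | /mem_msuppMX [m1 _ ->]].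
  by exists m1; [left|].
by exists m0; [right | apply: lem_addr].
Qed.

Definition variables (l : seq 'I_n) (m : 'X_{1..n}) :=
  exists2 i, i \in l & m = U_(i)%MM.

(** The last two hypotheses make the variables in [l] generate the colon ideal by [m0]. Its Betti
    numbers are assumed, so that the lemma can also serve to prove them in [koszul_betti]. *)
Lemma linear_quotient_cone M b m0 (l : seq 'I_n) :
  has_betti (monomial_ideal M) b ->
  has_betti (monomial_ideal (variables l))
    (fun p j => ((j == p.+1) * 'C(size l, p.+1))%N) ->
  (forall p j, (p + mdeg m0 < j)%N -> b p j = 0%N) ->
  (forall i, i \in l -> exists2 m1, M m1 & (m1 <= m0 + U_(i))%MM) ->
  (forall m1, M m1 -> exists2 i, i \in l & (m0 i < m1 i)%N) ->
  has_betti (monomial_ideal (fun m => M m \/ m = m0))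
    (fun p j => (b p j + (j == p + mdeg m0) * 'C(size l, p))%N).
Proof.
move=> bM bl bnd hl hM.
have h := @mapping_cone F n _ (monomial_ideal (fun m => M m \/ m = m0))
  _ _ _ 'X_[m0] (mdeg m0) bM bl.
apply: has_betti_ext (h _ _ _ bnd _) => //.
- move=> [|p] j; rewrite ?add0n ?bin0 ?muln1 //; congr (_ + _)%N.
  case: leqP => h'; last by case: eqP => // ?; lia.
  by congr (nat_of_bool _ * _)%N; lia.
- by move=> m; rewrite msuppX inE => /eqP->.
- move=> g; split=> hg m.
    case/mem_msuppMX=> m1 /hg [_ [i il ->] le_i] ->.
    have [m2 Mm2 le2] := hl i il; exists m2 => //.
    by apply: lepm_trans le2 _; apply/mnm_lepP => x; rewrite !mnmDE leq_add2l; apply/mnm_lepP.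
  move=> mg; have : (m0 + m)%MM \in msupp (g * 'X_[m0]).
    by rewrite (perm_mem (msuppMX _ _)) map_f.
  move=> /hg [m1 /hM [i il lt_i] /mnm_lepP /(_ i)]; rewrite mnmDE => le_i.
  by exists U_(i)%MM; [exists i | rewrite lep1mP; lia].
- by move=> g; apply: monomial_ideal_add.
by move=> p j le_jp; case: eqP => // ?; lia.
Qed.

Lemma monomial_ideal_nil M : (forall m, ~ M m) -> has_betti (monomial_ideal M) (fun _ _ => 0%N).
Proof.
move=> M0; apply: has_betti_ext (has_betti0 F n) => // g; split=> [-> m | hg].
  by rewrite mcoeff_msupp mcoeff0 eqxx.
apply: msuppnil0; case e : (msupp g) => [//|m r].
by have [|m0 /M0] := hg m; rewrite ?e ?mem_head.
Qed.

(** Variables are added one at a time: the colon ideal is again the ideal of the earlier ones, and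
    Pascal's rule sums the two contributions. *)
Lemma koszul_betti (l : seq 'I_n) : uniq l ->
  has_betti (monomial_ideal (variables l)) (fun p j => ((j == p.+1) * 'C(size l, p.+1))%N).
Proof.
elim: l => [_ | i l IH /= /andP [il ul]].
  apply: has_betti_ext (monomial_ideal_nil (M := variables [::]) _) => [g|p j|m []] //.
  by rewrite muln0.
have h := @linear_quotient_cone _ _ U_(i)%MM l (IH ul) (IH ul).
apply: has_betti_ext (h _ _ _).
- move=> g; split; apply: monomial_ideal_sub => m.
    move=> [[j jl ->]| ->]; [exists U_(j)%MM | exists U_(i)%MM]; rewrite ?lepm_refl //.
      by exists j => //; rewrite inE jl orbT.
    by exists i => //; rewrite mem_head.
  move=> [j]; rewrite inE => /orP [/eqP -> | jl] ->; [exists U_(i)%MM | exists U_(j)%MM];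
    rewrite ?lepm_refl //; [by right | by left; exists j].
- by move=> p j; rewrite mdeg1 addn1 -mulnDr -binS.
- by move=> p j; rewrite mdeg1 => lt_j; case: eqP => // ?; lia.
- by move=> j jl; exists U_(j)%MM; [exists j | apply: lem_addl].
move=> _ [j jl ->]; exists j => //; rewrite !mnm1E eqxx.
by case: eqP il => // ->; rewrite jl.
Qed.

Lemma linear_quotient M b m0 (l : seq 'I_n) :
  has_betti (monomial_ideal M) b -> uniq l ->
  (forall p j, (p + mdeg m0 < j)%N -> b p j = 0%N) ->
  (forall i, i \in l -> exists2 m1, M m1 & (m1 <= m0 + U_(i))%MM) ->
  (forall m1, M m1 -> exists2 i, i \in l & (m0 i < m1 i)%N) ->
  has_betti (monomial_ideal (fun m => M m \/ m = m0))
    (fun p j => (b p j + (j == p + mdeg m0) * 'C(size l, p))%N).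
Proof. by move=> bM ul; apply: linear_quotient_cone (koszul_betti ul). Qed.

Definition bits_monom (s : bitseq) : 'X_{1..n} :=
  [multinom (nth false s i : nat) | i < n].

Lemma count_bitsE (s : bitseq) : count id s = (\sum_(b <- s) b)%N.
Proof. by elim: s => [|b s IH]; rewrite ?big_nil // big_cons -IH. Qed.

Lemma mdeg_bits_monom s : size s = n -> mdeg (bits_monom s) = count id s.
Proof.
move=> hs; rewrite mdegE count_bitsE (big_nth false) big_mkord hs.
by apply: eq_bigr => i _; rewrite mnmE.
Qed.

(** The head of [L] has the largest degree and is added last, to the ideal of the tail. By the last
    hypothesis the tail holds every generator of degree below that of the head, among them the
    divisors from [first_hit_add]. *)
Lemma first_hit_betti k (L : seq bitseq) :
  uniq L -> pairwise (fun s t => count id t <= count id s)%N L ->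
  (forall s, s \in L -> first_hit k s /\ size s = n) ->
  (forall s t, s \in L -> first_hit k t -> size t = n -> (count id t < count id s)%N -> t \in L) ->
  has_betti (monomial_ideal (fun m => exists2 s, s \in L & m = bits_monom s))
    (fun p j => (\sum_(s <- L) (j == p + count id s) * 'C(count id s - k, p))%N).
Proof.
elim: L => [_ _ _ _ | s L IH /= /andP [sL uL] /andP [sP pL] hL cL].
  apply: has_betti_ext (monomial_ideal_nil
    (M := fun m => exists2 s, s \in [::] & m = bits_monom s) _) => [g|p j|m []] //.
  by rewrite big_nil.
have [fs ss] : first_hit k s /\ size s = n by apply: hL; rewrite mem_head.
have hL' t : t \in L -> first_hit k t /\ size t = n.
  by move=> tL; apply: hL; rewrite inE tL orbT.
have {}IH : has_betti (monomial_ideal (fun m => exists2 s, s \in L & m = bits_monom s))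
    (fun p j => (\sum_(s <- L) (j == p + count id s) * 'C(count id s - k, p))%N).
  apply: IH => // t u tL fu su lt_ut.
  have := cL t u; rewrite !inE tL orbT => /(_ isT fu su lt_ut) /orP [/eqP eu | //].
  by have /allP /(_ t tL) := sP; rewrite -eu leqNgt lt_ut.
pose l := [seq i <- enum 'I_n | nth false (down_steps k s) (i : 'I_n)].
have sl : size l = (count id s - k)%N.
  rewrite (count_down_steps fs) addKn size_filter.
  rewrite -(count_map val (nth false (down_steps k s))) val_enum_ord.
  rewrite -[in RHS](mkseq_nth false (down_steps k s)) size_down_steps ss.
  by rewrite count_map.
have := linear_quotient (m0 := bits_monom s) (l := l) IH (filter_uniq _ (enum_uniq _)).
rewrite mdeg_bits_monom // sl => h; apply: has_betti_ext (h _ _ _).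
- move=> g; split; apply: monomial_ideal_sub => m.
    move=> [[t tL ->] | ->]; [exists (bits_monom t) | exists (bits_monom s)]; rewrite ?lepm_refl //.
      by exists t => //; rewrite inE tL orbT.
    by exists s => //; rewrite mem_head.
  move=> [t]; rewrite inE => /orP [/eqP -> | tL] ->; [exists (bits_monom s) | exists (bits_monom t)];
    rewrite ?lepm_refl //; [by right | by left; exists t].
- by move=> p j; rewrite big_cons addnC.
- move=> p j lt_j; rewrite big_seq big1 // => t tL.
  have /allP /(_ t tL) := sP; case: eqP => //= ?; lia.
- move=> i; rewrite mem_filter => /andP [/(first_hit_add fs) [t [ft st ct le_t]] _].
  have tL : t \in L.
    have := cL s t; rewrite mem_head st ss => /(_ isT ft erefl ct).
    by rewrite inE => /orP [/eqP et | //]; rewrite et ltnn in ct.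
  exists (bits_monom t); first by exists t.
  apply/mnm_lepP => j; rewrite mnmDE !mnmE; case ej: (nth false t j) => //.
  case: (le_t _ ej) => [-> // | /val_inj ->]; by rewrite eqxx addn1.
(* Conversely, a generator in the tail has no larger degree, so it contains a variable at a down
   step of [s], which [s] itself lacks. *)
move=> _ [t tL ->]; have [ft st] := hL' t tL.
have [|||i /andP [di ti]] := first_hit_diff fs ft _ (leqnn k); rewrite ?ss ?st //.
- by move=> [est]; rewrite est tL in sL.
- by have /allP /(_ t tL) := sP; lia.
have lt_in : (i < n)%N.
  by rewrite -st ltnNge; apply/negP => le_i; rewrite nth_default in ti.
exists (Ordinal lt_in); first by rewrite mem_filter di mem_enum.
by rewrite !mnmE /= ti (negbTE (down_steps_notin di)).
Qed.

End MonomialIdeals.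

(** * The squarefree algebra *)

Section SquarefreeAlgebra.
Local Open Scope ring_scope.
Import GRing.Theory.
Variable F : fieldType.
Implicit Types (f g h : bitseq -> F) (s t : bitseq).

(* Multiplication by the sum of the variables modulo their squares, on
   coefficient functions. *)
Definition ell f : bitseq -> F := fun s =>
  \sum_(i < size s) if nth false s i then f (set_nth false s i false) else 0.

Lemma ell_nil f : ell f [::] = 0.
Proof. by rewrite /ell big_ord0. Qed.

Lemma ell_cons f b s :
  ell f (b :: s) = (if b then f (false :: s) else 0) + ell (fun t => f (b :: t)) s.
Proof. by rewrite /ell big_ord_recl. Qed.

Lemma ell_lin a c f g :
  ell (fun t => a * f t + c * g t) = fun t => a * ell f t + c * ell g t.
Proof.
apply: functional_extensionality => s; rewrite /ell !mulr_sumr -big_split.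
by apply: eq_bigr => i _ /=; case: ifP; rewrite ?mulr0 ?addr0.
Qed.

Lemma iter_ell_lin k a c f g :
  iter k ell (fun t => a * f t + c * g t) =
  fun t => a * iter k ell f t + c * iter k ell g t.
Proof. by elim: k => //= k ->; rewrite ell_lin. Qed.

Lemma iter_ell_false k f s :
  iter k ell f (false :: s) = iter k ell (fun t => f (false :: t)) s.
Proof.
elim: k s => //= k IH s; rewrite ell_cons add0r; congr (ell _ s).
exact: functional_extensionality.
Qed.

(** [(x + ell)^k = ell^k + k x ell^(k - 1)] for the first variable [x], as [x^2 = 0]. The factor [1]
    keeps the shape of [iter_ell_lin]. *)
Lemma iter_ell_true k f s : iter k ell f (true :: s) =
  k%:R * iter k.-1 ell (fun t => f (false :: t)) s + 1 * iter k ell (fun t => f (true :: t)) s.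
Proof.
elim: k s => [|k IH] s; first by rewrite mul0r add0r mul1r.
rewrite iterS ell_cons iter_ell_false.
have -> : (fun t => iter k ell f (true :: t)) = (fun t =>
    k%:R * iter k.-1 ell (fun t => f (false :: t)) t + 1 * iter k ell (fun t => f (true :: t)) t).
  exact: functional_extensionality.
rewrite ell_lin addrA; congr (_ + _); rewrite -add1n natrD mulrDl mul1r; congr (_ + _).
by case: k {IH} => [|k]; rewrite ?mul0r.
Qed.

Lemma ell_local n f g : (forall s, size s = n -> f s = g s) ->
  forall s, size s = n -> ell f s = ell g s.
Proof.
move=> efg s ss; apply: eq_bigr => i _; case: ifP => // _; apply: efg.
by rewrite size_set_nth (maxn_idPr _).
Qed.

Lemma iter_ell_local n k f g : (forall s, size s = n -> f s = g s) ->
  forall s, size s = n -> iter k ell f s = iter k ell g s.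
Proof. by move=> efg; elim: k => //= k; apply: ell_local. Qed.

Hypothesis charF : [pchar F] =i pred0.

Lemma natrS_neq0 k : k.+1%:R != 0 :> F.
Proof. by have /pcharf0P -> := charF. Qed.

(* With [x] the first variable and [f = f0 + x f1], the preimage comes from
   [(x + ell)^k (h1 / k + ell h2 - k x h2) =
    (ell^k h1 / k + ell^(k + 1) h2) + x ell^(k - 1) h1]. *)
Lemma iter_ell_onto_hits n k f : exists h, forall s, size s = n -> hits k s ->
  iter k ell h s = f s.
Proof.
elim: n k f => [|n IH] [|k] f; try by exists f.
  by exists f => s /size0nil ->.
have [h1 e1] := IH k (fun t => f (true :: t)).
have [h2 e2] := IH k.+2 (fun t => f (false :: t) - k.+1%:R^-1 * iter k.+1 ell h1 t).
have nz := natrS_neq0 k.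
exists (fun s => if s is b :: t then
    if b then - k.+1%:R * h2 t + 0 * h2 t else k.+1%:R^-1 * h1 t + 1 * ell h2 t
  else 0).
move=> [|[] s] // [ss] hs.
  rewrite iter_ell_true !iter_ell_lin -iterSr -(e1 s ss hs) /=.
  by field; rewrite nat1r.
rewrite iter_ell_false iter_ell_lin -iterSr (e2 s ss hs).
by rewrite mul1r addrC subrK.
Qed.

Variables (N : nat) (le : rel 'X_{1..N}).
Hypothesis le_order : term_order le.
Hypothesis le_vars : forall i j : 'I_N, (i < j)%N -> le U_(j)%MM U_(i)%MM.

(* A bit string shorter than [N] records the exponents of the last variables. *)
Definition suffix_monom s : 'X_{1..N} :=
  bits_monom N (nseq (N - size s) false ++ s).

Lemma suffix_monomE s (i : 'I_N) :
  suffix_monom s i = ((N - size s <= i)%N && nth false s (i - (N - size s))) :> nat.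
Proof.
rewrite mnmE nth_cat size_nseq nth_nseq ltnNge.
by case: leqP => //= _; case: ifP.
Qed.

Lemma suffix_monom_cons b s (lt_sN : (size s < N)%N) :
  exists2 j : 'I_N, (j + (size s).+1)%N = N &
  suffix_monom (b :: s) = (suffix_monom s + U_(j) *+ b)%MM.
Proof.
have lt_j : (N - (size s).+1 < N)%N by lia.
exists (Ordinal lt_j) => /=; first by lia.
apply/mnmP => i; rewrite mnmDE mulmnE mnm1E !suffix_monomE /= -val_eqE /=.
case: (ltngtP i (N - (size s).+1)%N) => [lt_i | gt_i | ->].
- by rewrite mul0n addn0 [(_ <= i)%N]leqNgt [X in ~~ X](leq_trans lt_i) //; lia.
- have -> : (N - size s <= i)%N by lia.
  have -> : (i - (N - (size s).+1) = (i - (N - size s)).+1)%N by lia.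
  by rewrite mul0n addn0.
have -> : (N - size s <= N - (size s).+1)%N = false by lia.
by rewrite subnn mul1n; case: b.
Qed.

Lemma suffix_monom_unset s i (j : 'I_N) : (size s <= N)%N -> nth false s i ->
  (N - size s + i = j)%N ->
  suffix_monom s = (suffix_monom (set_nth false s i false) + U_(j))%MM.
Proof.
move=> le_s si ej; have lt_i : (i < size s)%N.
  by rewrite ltnNge; apply/negP => le_i; rewrite nth_default in si.
apply/mnmP => l; rewrite mnmDE mnm1E !suffix_monomE size_set_nth (maxn_idPr lt_i).
rewrite nth_set_nth /= -val_eqE /= -ej.
case: leqP => /= le_l; last by case: eqP => //; lia.
case: (eqVneq (l - (N - size s))%N i) => [e | ne].
  by rewrite e si; case: eqP => //; lia.
by case: eqP => [|_]; [lia | rewrite addn0].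
Qed.

(* The functional dual to [s] that vanishes on the multiples of [ell ^ k]: its
   other coefficients sit only at larger monomials. *)
Lemma unhit_functional k s : (size s <= N)%N -> ~~ hits k s ->
  exists phi : (bitseq -> F) -> F,
  [/\ forall a c f g, phi (fun t => a * f t + c * g t) = a * phi f + c * phi g,
      forall f, phi (iter k ell f) = 0
    & forall f, (forall t, size t = size s -> le (suffix_monom s) (suffix_monom t) ->
                  t <> s -> f t = 0) -> phi f = f s].
Proof.
have [[le_refl le_anti le_trans le_total] [le0 leD]] := le_order.
elim: s k => [|b s IH] [|k] // le_s.
  by move=> _; exists (fun f => f [::]); split=> // f; rewrite iterS ell_nil.
have {}le_s : (size s < N)%N by [].
have [j ej eb] := suffix_monom_cons b le_s.
case: b eb => eb; [move=> /(IH k (ltnW le_s)) | move=> /(IH k.+2 (ltnW le_s))];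
    move=> [phi [phiL phi0 phiE]].
  (* For [f = f0 + x f1], the coefficient of [(x + ell)^(k + 1) f] at [x] is
     [(k + 1) ell^k f0 + ell^(k + 1) f1], a multiple of [ell^k]. *)
  exists (fun f => phi (fun t => f (true :: t))); split.
  - by move=> a c f g; rewrite phiL.
  - move=> f; rewrite (functional_extensionality _ _ (iter_ell_true k.+1 f)).
    by rewrite phiL phi0 iterSr phi0 !mulr0 addr0.
  move=> f hf; apply: phiE => t st le_st ne_ts; apply: hf; rewrite /= ?st //; last by case.
  have [i ei ->] : exists2 i : 'I_N, (i + (size t).+1)%N = N &
      suffix_monom (true :: t) = (suffix_monom t + U_(i) *+ true)%MM.
    by apply: suffix_monom_cons; rewrite st.
  rewrite eb; have -> : i = j by apply: val_inj => /=; lia.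
  exact: leD.
(* On [(x + ell)^(k + 1) f] the second term cancels [phi] of [ell^(k + 1) f0]; what remains is a
   multiple of [ell^(k + 2)], killed by [phi]. *)
exists (fun f => 1 * phi (fun t => f (false :: t)) +
                 - k.+1%:R^-1 * phi (ell (fun t => f (true :: t)))); split.
- by move=> a c f g; rewrite ell_lin !phiL; ring.
- move=> f.
  rewrite (functional_extensionality _ _ (iter_ell_true k.+1 f)).
  rewrite (functional_extensionality _ _ (iter_ell_false k.+1 f)).
  rewrite ell_lin phiL -!iterS phi0 /=; by field; rewrite nat1r natrS_neq0.
move=> f hf.
(* Replacing a variable of [t] by the new first one, which precedes it, only increases the
   monomial. *)
have le_unset t i : size t = size s -> le (suffix_monom s) (suffix_monom t) -> nth false t i ->
    le (suffix_monom (false :: s)) (suffix_monom (true :: set_nth false t i false)).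
  move=> st le_st ti; have lt_i : (i < size t)%N.
    by rewrite ltnNge; apply/negP => le_i; rewrite nth_default in ti.
  have lt_l : (N - size t + i < N)%N by rewrite /= in le_s; lia.
  rewrite eb mulm0n addm0; apply: le_trans le_st _.
  rewrite (@suffix_monom_unset t i (Ordinal lt_l)) ?st ?(ltnW le_s) //.
  have su : size (set_nth false t i false) = size s.
    by rewrite size_set_nth (maxn_idPr lt_i).
  have [|l el ->] := @suffix_monom_cons true (set_nth false t i false); first by rewrite su.
  rewrite mulm1n ![(suffix_monom _ + _)%MM]addmC; apply: leD.
  by apply: le_vars => /=; lia.
have ell0 t : size t = size s -> le (suffix_monom s) (suffix_monom t) ->
    ell (fun t => f (true :: t)) t = 0.
  move=> st le_st; rewrite /ell big1 // => i _; case: ifP => // ti.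
  apply: hf => //=; last exact: le_unset.
  by rewrite size_set_nth (maxn_idPr _) ?st // -st.
rewrite (phiE (ell _)); last by move=> t st le_st _; apply: ell0.
rewrite ell0 // mulr0 addr0 mul1r; apply: phiE => t st le_st ne_ts.
apply: hf; rewrite /= ?st //; last by case.
have [i ei ->] : exists2 i : 'I_N, (i + (size t).+1)%N = N &
    suffix_monom (false :: t) = (suffix_monom t + U_(i) *+ false)%MM.
  by apply: suffix_monom_cons; rewrite st.
by rewrite eb !mulm0n !addm0.
Qed.

End SquarefreeAlgebra.

(** * Squarefree monomials of the initial ideal *)

Section InitialIdeal.
Local Open Scope ring_scope.
Import GRing.Theory.
Variables (F : fieldType) (n k : nat).
Hypothesis charF : [pchar F] =i pred0.
Variable le : rel 'X_{1..n}.
Hypothesis le_order : term_order le.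
Hypothesis le_vars : forall i j : 'I_n, (i < j)%N -> le U_(j)%MM U_(i)%MM.
Local Notation R := {mpoly F[n]}.

(** The class of [p] modulo the squares of the variables; strings of other lengths get 0, so that
    [sqfree_coef_ell] holds on all strings. *)
Definition sqfree_coef (p : R) : bitseq -> F :=
  fun s => if size s == n then p@_(bits_monom n s) else 0.

Lemma mcoeff_mulX (p : R) m0 m :
  (p * 'X_[m0])@_m = if (m0 <= m)%MM then p@_(m - m0) else 0.
Proof.
case: ifP => [le_m | nle]; first by rewrite -{1}(submK le_m) addmC mcoeffMX.
apply/eqP; rewrite mcoeff_eq0; apply/negP => /mem_msuppMX [m1 _ e].
by rewrite e lem_addr in nle.
Qed.

Lemma sqfree_coef_lin a c p q :
  sqfree_coef (a *: p + c *: q) = fun s => a * sqfree_coef p s + c * sqfree_coef q s.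
Proof.
apply: functional_extensionality => s; rewrite /sqfree_coef.
by case: ifP => _; rewrite ?mcoeffD ?mcoeffZ // !mulr0 addr0.
Qed.

Lemma sqfree_coef0 : sqfree_coef 0 = fun=> 0.
Proof.
by apply: functional_extensionality => s; rewrite /sqfree_coef mcoeff0 if_same.
Qed.

Lemma sqfree_coef_sqr p i : sqfree_coef (p * 'X_i ^+ 2) = fun=> 0.
Proof.
apply: functional_extensionality => s; rewrite /sqfree_coef mpolyXn mcoeff_mulX.
case: ifP => // _; case: ifP => // /mnm_lepP /(_ i).
by rewrite mulmnE mnm1E eqxx mnmE; case: nth.
Qed.

Lemma ell_size (f : bitseq -> F) s : size s = n ->
  ell f s = \sum_(i < n) if nth false s i then f (set_nth false s i false) else 0.
Proof. by move=> <-. Qed.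

Lemma sqfree_coef_ell p : sqfree_coef (p * \sum_(i < n) 'X_i) = ell (sqfree_coef p).
Proof.
apply: functional_extensionality => s; rewrite {1}/sqfree_coef.
case: eqP => ss; last first.
  rewrite /ell big1 // => i _; case: ifP => // _.
  by rewrite /sqfree_coef size_set_nth (maxn_idPr _) //; case: eqP.
rewrite (ell_size _ ss) mulr_sumr raddf_sum /=; apply: eq_bigr => i _.
rewrite mcoeff_mulX lep1mP mnmE /sqfree_coef size_set_nth (maxn_idPr _) ?ss ?eqxx //.
case si : (nth false s i) => //=; congr (p@__).
apply/mnmP => j; rewrite mnmBE mnm1E !mnmE nth_set_nth /= -val_eqE /= eq_sym.
by case: eqP => [->|_]; rewrite ?si ?subn0.
Qed.

Lemma sqfree_coef_iter p j :
  sqfree_coef (p * (\sum_(i < n) 'X_i) ^+ j) = iter j (@ell F) (sqfree_coef p).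
Proof. by elim: j p => [|j IH] p; rewrite ?mulr1 // exprSr mulrA sqfree_coef_ell IH. Qed.

Lemma bits_monom_inj s t : size s = n -> size t = n ->
  bits_monom n s = bits_monom n t -> s = t.
Proof.
move=> ss st /mnmP e; apply: (@eq_from_nth _ false); first by rewrite ss.
move=> i; rewrite ss => lt_i; have := e (Ordinal lt_i); rewrite !mnmE /=.
by do 2!case: nth.
Qed.

Lemma squarefree_bits m : squarefree_monom m ->
  exists2 s, size s = n & m = bits_monom n s.
Proof.
move=> sqm; exists [seq m i == 1%N | i <- enum 'I_n]; first by rewrite size_map size_enum_ord.
apply/mnmP => i; rewrite mnmE (nth_map i) ?size_enum_ord // nth_ord_enum.
by have := sqm i; case: (m i) => [|[]].
Qed.

Lemma squarefree_bits_monom s : squarefree_monom (bits_monom n s).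
Proof. by move=> i; rewrite mnmE; case: nth. Qed.

(** If [s] did not hit, its functional would kill every element of the ideal, yet return the nonzero
    leading coefficient of [f]. *)
Lemma leading_hits f s : I_nk F n k f -> size s = n ->
  leading_monom le f (bits_monom n s) -> hits k s.
Proof.
have [[_ le_anti _ _] _] := le_order.
move=> [l [hl ef]] ss [sf smax]; apply/negPn/negP => nhs.
have [|phi [phiL phi0 phiE]] := unhit_functional charF le_order le_vars _ nhs; first by rewrite ss.
suff : phi (sqfree_coef f) = 0.
  rewrite phiE; first by rewrite /sqfree_coef ss eqxx => /eqP; rewrite mcoeff_eq0 sf.
  move=> t; rewrite /suffix_monom ss => st; rewrite st subnn /= => le_st ne_ts.
  rewrite /sqfree_coef st eqxx; apply/eqP; rewrite mcoeff_eq0; apply/negP => /smax le_ts.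
  by apply/ne_ts/bits_monom_inj => //; apply: le_anti; rewrite le_ts.
have phiz : phi (fun=> 0) = 0.
  by have := phiL 0 0 (fun=> 0) (fun=> 0); rewrite /= !mul0r !addr0.
rewrite ef big_seq; apply: (big_ind (fun p => phi (sqfree_coef p) = 0)).
- by rewrite sqfree_coef0.
- move=> p q hp hq; rewrite -[p]scale1r -[q]scale1r sqfree_coef_lin phiL.
  by rewrite hp hq !mulr0 addr0.
move=> x /hl [[i ->] | ->]; first by rewrite sqfree_coef_sqr.
by rewrite sqfree_coef_iter phi0.
Qed.

Lemma leading_exists (p : R) : p != 0 -> exists m, leading_monom le p m.
Proof.
have [[le_refl _ le_trans le_total] _] := le_order.
rewrite -msupp_eq0 /leading_monom; elim: (msupp p) => // m r IH _.
case: (eqVneq r [::]) => [-> | /IH [m1 [m1r max1]]].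
  by exists m; split=> [|m']; rewrite inE // => /eqP->; apply: le_refl.
case/orP: (le_total m m1) => [le_mm1 | le_m1m].
  exists m1; rewrite inE m1r orbT; split=> // m'.
  by rewrite inE => /orP [/eqP-> | /max1].
exists m; rewrite mem_head; split=> // m'.
by rewrite inE => /orP [/eqP-> | /max1 h]; [apply: le_refl | apply: le_trans h le_m1m].
Qed.

Lemma mcoeff_bits_sum (f : bitseq -> F) s : size s = n ->
  (\sum_(t <- all_bits n) f t *: 'X_[bits_monom n t] : R)@_(bits_monom n s) = f s.
Proof.
move=> ss; rewrite raddf_sum /= (bigD1_seq s) ?mem_all_bits ?ss ?all_bits_uniq //=.
rewrite mcoeffZ mcoeffX eqxx mulr1 big_seq_cond big1 ?addr0 // => t.
rewrite mem_all_bits => /andP [/eqP st ne_ts].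
rewrite mcoeffZ mcoeffX; case: eqP => [/bits_monom_inj e|]; last by rewrite mulr0.
by rewrite e ?eqxx in ne_ts.
Qed.

Lemma squarefree_part_mod (q : R) :
  monomial_ideal (fun m => exists i, m = (U_(i) *+ 2)%MM)
    (q - \sum_(s <- all_bits n) sqfree_coef q s *: 'X_[bits_monom n s]).
Proof.
move=> m mq; have [sqm | /forallPn [i]] := boolP [forall i, m i <= 1]%N; last first.
  rewrite -ltnNge => lt_m; exists (U_(i) *+ 2)%MM; first by exists i.
  by apply/mnm_lepP => j; rewrite mulmnE mnm1E; case: eqP => [<-|_]; lia.
have [s ss em] := squarefree_bits (fun i => forallP sqm i).
move: mq; rewrite em mcoeff_msupp mcoeffB mcoeff_bits_sum // /sqfree_coef ss eqxx.
by rewrite subrr eqxx.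
Qed.

(** Some multiple of the [k]-th power has coefficient 1 at [s] and 0 at every other string that
    hits. The leading monomial of its squarefree part has to hit, so it is the one of [s]. *)
Lemma hits_leading s : size s = n -> hits k s ->
  exists2 f, I_nk F n k f & leading_monom le f (bits_monom n s).
Proof.
move=> ss hs.
have [h hh] := iter_ell_onto_hits charF n k (fun t => (t == s)%:R).
pose P : R := \sum_(t <- all_bits n) h t *: 'X_[bits_monom n t].
pose q : R := P * (\sum_(i < n) 'X_i) ^+ k.
have qE t : size t = n -> hits k t -> sqfree_coef q t = (t == s)%:R.
  move=> st ht; rewrite sqfree_coef_iter -(hh t st ht); apply: iter_ell_local st.
  by move=> u su; rewrite /sqfree_coef su eqxx mcoeff_bits_sum.
pose f : R := \sum_(t <- all_bits n) sqfree_coef q t *: 'X_[bits_monom n t].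
have If : I_nk F n k f.
  have -> : f = q + (- 1) * (q - f) by rewrite mulN1r opprB addrC subrK.
  apply: ideal_genD; first by apply: ideal_genM; apply: ideal_gen_mem; right.
  apply: ideal_genM; have /ideal_gen_monomials := @squarefree_part_mod q; apply: ideal_gen_sub.
  by move=> g [m [[i ->] ->]]; apply: ideal_gen_mem; left; exists i; rewrite mpolyXn.
have fs : f@_(bits_monom n s) = 1 by rewrite mcoeff_bits_sum // qE // eqxx.
have nz : f != 0.
  by apply/eqP => f0; move: fs; rewrite f0 mcoeff0 => /eqP; rewrite eq_sym oner_eq0.
exists f => //; have [m lm] := leading_exists nz.
suff <- : m = bits_monom n s by [].
have [mf _] := lm.
have /flattenP [_ /mapP [t + ->]] := msupp_sum_le mf; rewrite mem_filter /= mem_all_bits => /eqP st.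
move=> /msuppZ_le; rewrite msuppX inE => /eqP em.
rewrite em in lm mf *; have ht := leading_hits If st lm.
move: mf; rewrite mcoeff_msupp mcoeff_bits_sum // qE //.
by case: (t =P s) => [-> | _]; rewrite ?eqxx.
Qed.

Lemma leading_mulX (f : R) m m' : leading_monom le f m ->
  leading_monom le (f * 'X_[m']) (m' + m)%MM.
Proof.
have [_ [_ leD]] := le_order.
move=> [mf mmax]; split; first by rewrite (perm_mem (msuppMX _ _)) map_f.
by move=> m1 /mem_msuppMX [m2 /mmax le2 ->]; rewrite ![(m' + _)%MM]addmC; apply: leD.
Qed.

Lemma initial_ideal_hits s : size s = n ->
  initial_ideal le (I_nk F n k) 'X_[bits_monom n s] <-> hits k s.
Proof.
move=> ss; split=> [hin | /(hits_leading ss) [f If lf]]; last first.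
  by apply: ideal_gen_mem; exists f, (bits_monom n s).
have : monomial_ideal (fun m => exists f, I_nk F n k f /\ leading_monom le f m)
    ('X_[bits_monom n s] : R).
  apply/ideal_gen_monomials; apply: ideal_gen_sub hin => g [f [m [If lf ->]]].
  by apply: ideal_gen_mem; exists m; split=> //; exists f.
move=> /(_ (bits_monom n s)); rewrite msuppX mem_head => /(_ isT) [m [f [If lf]] le_m].
(* A multiple of a leading monomial leads the corresponding multiple of [f]. *)
apply: (@leading_hits (f * 'X_[bits_monom n s - m])) => //.
  by rewrite mulrC; apply: ideal_genM.
by rewrite -{2}(submK le_m); apply: leading_mulX.
Qed.

Definition first_hit_bits := [seq s <- all_bits n | first_hit k s].

Lemma J_nk_first_hit f : J_nk F le k f <->
  monomial_ideal (fun m => exists2 s, s \in first_hit_bits & m = bits_monom n s) f.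
Proof.
have eJ : J_nk F le k f <-> monomial_ideal (fun m => squarefree_monom m /\
    initial_ideal le (I_nk F n k) 'X_[m]) f.
  rewrite -ideal_gen_monomials; split; apply: ideal_gen_sub => g.
    by move=> [m [sqm im ->]]; apply: ideal_gen_mem; exists m.
  by move=> [m [[sqm im] ->]]; apply: ideal_gen_mem; exists m.
rewrite eJ; split; apply: monomial_ideal_sub => m.
  move=> [/squarefree_bits [s ss ->]] /(initial_ideal_hits ss) /hits_first_hit.
  move=> [t [ft st le_ts]]; exists (bits_monom n t).
    by exists t => //; rewrite mem_filter ft mem_all_bits st ss /=.
  apply/mnm_lepP => i; rewrite !mnmE; have := le_ts i.
  by case: (nth false t i) => // ->.
move=> [s]; rewrite mem_filter mem_all_bits => /andP [fs /eqP ss] ->.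
exists (bits_monom n s); last exact: lepm_refl.
split; first exact: squarefree_bits_monom.
exact/initial_ideal_hits/first_hit_hits.
Qed.

Lemma J_nk_betti p j : graded_betti (J_nk F le k) p j =
  (\sum_(s <- first_hit_bits) (j == p + count id s) * 'C(count id s - k, p))%N.
Proof.
pose geq_count (s t : bitseq) := (count id t <= count id s)%N.
pose L := sort geq_count first_hit_bits.
have memL : L =i first_hit_bits by apply: mem_sort.
have hb : has_betti (J_nk F le k)
    (fun p j => \sum_(s <- L) (j == p + count id s) * 'C(count id s - k, p))%N.
  apply: has_betti_ext (@first_hit_betti F n k L _ _ _ _) => [g|||||] //.
  - rewrite J_nk_first_hit; split; apply: monomial_ideal_sub => m [s];
      rewrite ?memL => sL ->; exists (bits_monom n s); rewrite ?lepm_refl //;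
      by exists s; rewrite ?memL.
  - by rewrite sort_uniq filter_uniq // all_bits_uniq.
  - rewrite -sorted_pairwise; last by move=> t s u h1 h2; apply: leq_trans h2 h1.
    by apply: sort_sorted => s t; apply: leq_total.
  - by move=> s; rewrite memL mem_filter mem_all_bits => /andP [-> /eqP].
  by move=> s t _ ft st _; rewrite memL mem_filter ft mem_all_bits st /=.
rewrite (graded_bettiE _ _ charF hb); apply: perm_big.
by rewrite perm_sort.
Qed.

End InitialIdeal.

Theorem proposition4p4 (F : fieldType) (hF : [pchar F]%R =i pred0)
    (n k : nat) (hn : 0 < n) (hk : 0 < k)
    (le : rel 'X_{1..n}) (hle : term_order le)
    (hx : forall i j : 'I_n, i < j -> le U_(j)%MM U_(i)%MM)
    (p s : nat) :
  (n + k < 2 * s -> graded_betti (J_nk F le k) p (p + s) = 0) /\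
  (2 * s <= n + k ->
     graded_betti (J_nk F le k) p (p + s) =
       if s < k then 0 else catalan_pow k (s - k) * 'C(s - k, p)).
Proof.
(* Only the generators of degree [s] contribute in degree [p + s], each with ['C(s - k, p)]; there
   are none if [s < k] or [n + k < 2 * s]. *)
have -> : graded_betti (J_nk F le k) p (p + s) =
    (if (k <= s) && (2 * s <= n + k) then ballot (s - k) k else 0) * 'C(s - k, p).
  rewrite (J_nk_betti _ hF hle hx) -count_first_hit big_filter -sum1_count.
  rewrite big_distrl /= big_mkcond [RHS]big_mkcond /=; apply: eq_bigr => t _.
  rewrite eqn_add2l eq_sym; case: first_hit => //=.
  by case: eqP => [->|_]; rewrite ?mul1n.
rewrite catalan_powE; split=> hs; last by rewrite hs andbT leqNgt; case: ltnP.
by rewrite (leqNgt (2 * s)) hs andbF.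
Qed.
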